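(* For all $m,n\in\mathbb{Z}$, membership in every Magnus submonoid of the Baumslag--Solitar group $$BS(m,n)=\langle a,t\mid t a^m t^{-1}=a^n\rangle$$ is decidable.
   Context: The group is regarded as a one-relator group with relator $r = t a^m t^{-1}a^{-n}$. For a one-relator group $G=\langle A\mid r=1\rangle$, a letter $a\in A$ appears in $r$ if $a$ or $a^{-1}$ is a letter of $r$, and a Magnus submonoid of $G$ (with respect to this presentation) is a submonoid generated by a subset $X\subseteq A\cup A^{-1}$ such that there is a letter $a$ appearing in $r$ with $\{a,a^{-1}\}\not\subseteq X$. In particular, if every letter of $A$ appears in $r$, a Magnus submonoid is one generated by a strict subset of $A\cup A^{-1}$. For a group $G$ generated by a finite set $A$ and a finitely generated submonoid $M\leq G$, membership in $M$ is decidable if there is an algorithm that takes any word over $A\cup A^{-1}$ and decides whether the element of $G$ it represents belongs to $M$. *)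

(* Defs.v *)
From HB Require Import structures.
From mathcomp Require Import all_boot all_order all_algebra.
From mathcomp Require Import boolp classical_sets.

Set Implicit Arguments.
Unset Strict Implicit.
Unset Printing Implicit Defensive.

Local Open Scope quotient_scope.

(* Partial recursive functions.  Arguments are passed as a list: a projection
   beyond its end returns 0, and the successor, [PrimRec f g] and [Mu f] use
   the head of the list, respectively as argument, as recursion argument and as
   the variable that is minimized. *)
Inductive recfun : Type :=
| Zero
| Succ
| Proj of nat
| Comp of recfun & seq recfun
| PrimRec of recfun & recfun
| Mu of recfun.

(* [eval f v k] : on input [v], [f] halts with output [k]. *)
Inductive eval : recfun -> seq nat -> nat -> Prop :=
| eval_Zero v : eval Zero v 0
| eval_Succ k v : eval Succ (k :: v) k.+1
| eval_Proj i v : eval (Proj i) v (nth 0 v i)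
| eval_Comp f gs v w k : eval_seq gs v w -> eval f w k -> eval (Comp f gs) v k
| eval_PrimRec0 f g v k : eval f v k -> eval (PrimRec f g) (0 :: v) k
| eval_PrimRecS f g i v j k : eval (PrimRec f g) (i :: v) j ->
    eval g (i :: j :: v) k -> eval (PrimRec f g) (i.+1 :: v) k
(* [s] gives the (nonzero) values of [f] before its first zero. *)
| eval_Mu f v k (s : nat -> nat) : (forall i, i < k -> eval f (i :: v) (s i).+1) ->
    eval f (k :: v) 0 -> eval (Mu f) v k
with eval_seq : seq recfun -> seq nat -> seq nat -> Prop :=
| eval_nil v : eval_seq [::] v [::]
| eval_cons g gs v k w : eval g v k -> eval_seq gs v w ->
    eval_seq (g :: gs) v (k :: w).

(* [(x, false)] stands for the letter x and [(x, true)] for x^-1. *)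
Definition letter (A : finType) : finType := (A * bool)%type.
Definition word (A : finType) := seq (letter A).

Definition letter_inv (A : finType) (x : letter A) : letter A := (x.1, ~~ x.2).
Definition word_inv (A : finType) (w : word A) : word A :=
  rev (map (@letter_inv A) w).

(* Bijective numeration in base #|letter A|. *)
Definition word_code (A : finType) (w : word A) : nat :=
  foldr (fun x c => (enum_rank x).+1 + #|letter A| * c) 0 w.

Definition word_decidable (A : finType) (L : set (word A)) : Prop :=
  exists f : recfun, forall w : word A,
    (L w -> eval f [:: word_code w] 1) /\ (~ L w -> eval f [:: word_code w] 0).

Section Groups.
Local Open Scope group_scope.
Variables (A : finType) (G : groupType) (gen : A -> G).

Definition letter_val (x : letter A) : G :=
  if x.2 then (gen x.1)^-1 else gen x.1.

Definition word_val (w : word A) : G := \prod_(x <- w) letter_val x.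

Definition membership_decidable (M : set G) : Prop :=
  word_decidable [set w | M (word_val w)].

Definition submonoid (S : set G) : Prop :=
  S 1 /\ forall x y, S x -> S y -> S (x * y).

Definition submonoid_generated (X : set G) : set G := smallest submonoid X.

End Groups.

Section Presentation.
Variables (A : finType) (r : word A).

Inductive pres_eq : word A -> word A -> Prop :=
| pres_refl w : pres_eq w w
| pres_sym v w : pres_eq v w -> pres_eq w v
| pres_trans u v w : pres_eq u v -> pres_eq v w -> pres_eq u w
| pres_cancel u v x : pres_eq (u ++ [:: x; letter_inv x] ++ v) (u ++ v)
| pres_relator u v : pres_eq (u ++ r ++ v) (u ++ v).

Definition pres_eqb : rel (word A) := fun v w => `[< pres_eq v w >].

Lemma pres_eqb_refl : reflexive pres_eqb.
Proof. by move=> w; apply/asboolP/pres_refl. Qed.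

Lemma pres_eqb_sym : symmetric pres_eqb.
Proof. by move=> v w; apply/asboolP/asboolP => /pres_sym. Qed.

Lemma pres_eqb_trans : transitive pres_eqb.
Proof.
by move=> v u w /asboolP uv /asboolP vw; apply/asboolP/(pres_trans uv vw).
Qed.

Canonical pres_equiv :=
  EquivRel pres_eqb pres_eqb_refl pres_eqb_sym pres_eqb_trans.

(* The carrier of the group < A | r = 1 >. *)
Definition one_relator := {eq_quot pres_equiv}.

HB.instance Definition _ := Choice.on one_relator.

Definition word_class (w : word A) : one_relator := \pi w.

Lemma word_classP v w : word_class v = word_class w <-> pres_eq v w.
Proof.
by split => [/eqmodP/asboolP // | vw]; apply/eqmodP/asboolP.
Qed.

Lemma word_class_repr (x : one_relator) : word_class (repr x) = x.
Proof. exact: reprK. Qed.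

Lemma pres_ctx a b v w : pres_eq v w -> pres_eq (a ++ v ++ b) (a ++ w ++ b).
Proof.
elim=> {v w} [w|v w _|u v w _ uv _|u v x|u v].
- exact: pres_refl.
- exact: pres_sym.
- exact: pres_trans.
- by have := pres_cancel (a ++ u) (v ++ b) x; rewrite -!catA.
- by have := pres_relator (a ++ u) (v ++ b); rewrite -!catA.
Qed.

Lemma pres_cat v v' w w' :
  pres_eq v v' -> pres_eq w w' -> pres_eq (v ++ w) (v' ++ w').
Proof.
move=> /(@pres_ctx [::] w) /= vv' /(@pres_ctx v' [::]).
by rewrite !cats0; apply: pres_trans.
Qed.

Lemma letter_invK : involutive (@letter_inv A).
Proof. by case=> x b; rewrite /letter_inv /= negbK. Qed.

Lemma word_inv_cat (v w : word A) :
  word_inv (v ++ w) = word_inv w ++ word_inv v.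
Proof. by rewrite /word_inv map_cat rev_cat. Qed.

Lemma word_invK : involutive (@word_inv A).
Proof. by move=> w; rewrite /word_inv map_rev revK mapK //; exact: letter_invK. Qed.

Lemma pres_catV w : pres_eq (w ++ word_inv w) [::].
Proof.
elim: w => [|x w IHw]; first exact: pres_refl.
have := @pres_ctx [:: x] [:: letter_inv x] _ _ IHw.
rewrite -(cat1s x w) word_inv_cat -!catA => /pres_trans; apply.
exact: (pres_cancel [::] [::] x).
Qed.

Lemma pres_Vcat w : pres_eq (word_inv w ++ w) [::].
Proof. by have := pres_catV (word_inv w); rewrite word_invK. Qed.

Lemma pres_inv v w : pres_eq v w -> pres_eq (word_inv v) (word_inv w).
Proof.
move=> vw.
have /pres_sym h1 : pres_eq (word_inv v ++ w ++ word_inv w) (word_inv v).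
  rewrite -[X in pres_eq _ X]cats0.
  exact: pres_cat (pres_refl _) (pres_catV w).
apply: pres_trans h1 _; rewrite catA.
apply: (@pres_cat _ [::] _ (word_inv w)); last exact: pres_refl.
apply: pres_trans (pres_Vcat v).
exact: pres_cat (pres_refl _) (pres_sym vw).
Qed.

Definition pres_one : one_relator := word_class [::].
Definition pres_mul (x y : one_relator) : one_relator :=
  word_class (repr x ++ repr y).
Definition pres_opp (x : one_relator) : one_relator :=
  word_class (word_inv (repr x)).

Lemma repr_word_class w : pres_eq (repr (word_class w)) w.
Proof. exact/word_classP/word_class_repr. Qed.

Lemma pres_mulE v w :
  pres_mul (word_class v) (word_class w) = word_class (v ++ w).
Proof. by apply/word_classP/pres_cat; exact: repr_word_class. Qed.

Lemma pres_oppE w : pres_opp (word_class w) = word_class (word_inv w).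
Proof. by apply/word_classP/pres_inv; exact: repr_word_class. Qed.

Lemma pres_mulA : associative pres_mul.
Proof.
move=> x y z; rewrite -(word_class_repr x) -(word_class_repr y).
by rewrite -(word_class_repr z) !pres_mulE catA.
Qed.

Lemma pres_1mul : left_id pres_one pres_mul.
Proof. by move=> x; rewrite -(word_class_repr x) pres_mulE. Qed.

Lemma pres_mul1 : right_id pres_one pres_mul.
Proof. by move=> x; rewrite -(word_class_repr x) pres_mulE cats0. Qed.

Lemma pres_Vmul : left_inverse pres_one pres_opp pres_mul.
Proof.
move=> x; rewrite -(word_class_repr x) pres_oppE pres_mulE.
exact/word_classP/pres_Vcat.
Qed.

Lemma pres_mulV : right_inverse pres_one pres_opp pres_mul.
Proof.
move=> x; rewrite -(word_class_repr x) pres_oppE pres_mulE.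
exact/word_classP/pres_catV.
Qed.

HB.instance Definition _ := isGroup.Build one_relator
  pres_mulA pres_1mul pres_mul1 pres_Vmul pres_mulV.

Definition one_relator_gen (x : A) : one_relator := word_class [:: (x, false)].

Definition appears (x : A) : Prop := exists b, (x, b) \in r.

Definition magnus_submonoid (M : set one_relator) : Prop :=
  exists X : {set letter A},
    (exists x, appears x /\ ~~ ([set (x, false); (x, true)] \subset X)) /\
    M = submonoid_generated
          [set g | exists2 x, x \in X & g = letter_val one_relator_gen x].

End Presentation.

Arguments one_relator_gen {A} r x.

Inductive bs_letter := bs_a | bs_t.

Definition bs_letter_bool (x : bs_letter) : bool :=
  if x is bs_a then false else true.
Definition bool_bs_letter (b : bool) : bs_letter := if b then bs_t else bs_a.

Lemma bs_letter_boolK : cancel bs_letter_bool bool_bs_letter.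
Proof. by case. Qed.

HB.instance Definition _ := Finite.copy bs_letter (can_type bs_letter_boolK).

Definition letter_pow (A : finType) (x : letter A) (k : int) : word A :=
  match k with
  | Posz i => nseq i x
  | Negz i => nseq i.+1 (letter_inv x)
  end.

(* The relator is taken literally, without reduction: for m = n = 0 it is
   t t^-1, in which the letter t appears. *)
Definition BS_relator (m n : int) : word bs_letter :=
  [:: (bs_t, false)] ++ letter_pow (bs_a, false) m
  ++ [:: (bs_t, true)] ++ letter_pow (bs_a, false) (- n)%R.

Notation BS m n := (one_relator (BS_relator m n)).

(* Main.v *)
Require Import Defs.
From mathcomp Require Import all_boot all_order all_algebra.
From mathcomp Require Import boolp classical_sets.
From mathcomp Require Import zify ring.

(** The group is an HNN extension of a cyclic group generated by a, with stable
letter t, and the proof reads membership off Britton normal forms.  Every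
element is uniquely a product

    (a^r1 t^s1) (a^r2 t^s2) ... (a^rp t^sp) a^e

in which each r_i is the remainder of a Euclidean division by n or m, according
to the sign s_i, and no factor t^s a^0 t^-s occurs.  Right multiplication by a
letter acts on such forms: a changes the last exponent, and t^s splits it as
e = r + d q, keeps r, and sends a^(d q) across t^s.  The action respects the
defining relations ([foldl_pres_eq]), so the form of a word depends only on the
element that it represents, and evaluating the form gives this element back
([state_val_foldl]).  The only change needed when m or n vanishes is to reduce
the last exponent modulo the order of a, which is then finite unless m = n = 0.

Let K be generated by a set X of letters.  Inverting the letter a if necessary,
assume that a is in X as soon as a^-1 is; the inverted letter satisfies the same
relation t a^m = a^n t.  Which normal forms lie in K?  The letters t^s occurring
in them must be in X.  If neither a nor a^-1 is in X, all exponents must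
vanish; if both are, nothing else is required.  If only a is, and
m n >= 0, all exponents must be nonnegative: moving a^(d q) across t^s keeps
exponents nonnegative, and the division leaves as little as possible behind.
If only a is and m n < 0, then t^s a^-1 is a product of nonnegative powers of a
and t^s, so a negative last exponent does no harm once some t^s precedes it, or
once t and t^-1 are both available.  That K only contains such forms is
checked one letter at a time ([accepted_act]); that such forms lie in K is a
computation in the group ([accepted_submonoid]).

Decidability then says that a word automaton with a computable action on
numerical codes of its states decides a recursive language
([word_decidable_automaton]); the first half of the development builds the
recursive functions that this takes. *)

Set Implicit Arguments.
Unset Strict Implicit.
Unset Printing Implicit Defensive.

Import Order.TTheory GRing.Theory Num.Theory.

(** * Closure properties of the recursive functions *)

(** The domain [T] is arbitrary and [env] lists the numbers that represent its
elements: functions of several numbers and functions of codes of structured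
data are then composed in the same way, and only the codes that occur matter. *)
Definition recursive T (env : T -> seq nat) (F : T -> nat) : Prop :=
  exists f, forall x, eval f (env x) (F x).

Definition recursive_bool T (env : T -> seq nat) (P : T -> bool) : Prop :=
  recursive env (fun x => P x : nat).

Section Closure.
Variables (T : Type) (env : T -> seq nat).
Implicit Types (F G H : T -> nat) (P Q : T -> bool).

Lemma recursive_ext F G : F =1 G -> recursive env F -> recursive env G.
Proof. by move=> eqFG [f fP]; exists f => x; rewrite -eqFG. Qed.

Lemma recursive_const k : recursive env (fun=> k).
Proof.
elim: k => [|k [f fP]]; first by exists Zero => x; constructor.
exists (Comp Succ [:: f]) => x; apply: eval_Comp (eval_Succ _ [::]).
by do !constructor.
Qed.

Lemma recursive_nth i : recursive env (fun x => nth 0 (env x) i).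
Proof. by exists (Proj i) => x; constructor. Qed.

Lemma recursive_comp1 T1 (c1 : T1 -> nat) h (f1 : T -> T1) :
  recursive (fun y => [:: c1 y]) h ->
  recursive env (fun x => c1 (f1 x)) -> recursive env (fun x => h (f1 x)).
Proof.
case=> f fP [g gP]; exists (Comp f [:: g]) => x.
by apply: eval_Comp (fP _); do !constructor.
Qed.

Lemma recursive_comp2 T1 T2 (c1 : T1 -> nat) (c2 : T2 -> nat)
    (h : T1 -> T2 -> nat) (f1 : T -> T1) (f2 : T -> T2) :
  recursive (fun p => [:: c1 p.1; c2 p.2]) (fun p => h p.1 p.2) ->
  recursive env (fun x => c1 (f1 x)) -> recursive env (fun x => c2 (f2 x)) ->
  recursive env (fun x => h (f1 x) (f2 x)).
Proof.
case=> f fP [g gP] [g' gP']; exists (Comp f [:: g; g']) => x.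
by apply: eval_Comp (fP (_, _)); do !constructor.
Qed.

Lemma recursive_succ F : recursive env F -> recursive env (fun x => (F x).+1).
Proof.
apply: (recursive_comp1 (c1 := id) (h := succn)).
exists Succ => x; exact: eval_Succ.
Qed.

(** The accumulator ranges over a type of coded values, so the step has to be
computed correctly on codes only. *)
Lemma recursive_primrec Y (codeY : Y -> nat) (R : nat -> T -> Y)
    (B : T -> Y) (S : nat -> Y -> T -> Y) :
  (forall x, R 0 x = B x) -> (forall i x, R i.+1 x = S i (R i x) x) ->
  recursive env (fun x => codeY (B x)) ->
  recursive (fun p : nat * Y * T => p.1.1 :: codeY p.1.2 :: env p.2)
    (fun p => codeY (S p.1.1 p.1.2 p.2)) ->
  recursive (fun p : nat * T => p.1 :: env p.2) (fun p => codeY (R p.1 p.2)).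
Proof.
move=> R0 RS [b bP] [s sP]; exists (PrimRec b s) => -[i x] /=.
elim: i => [|i IHi]; first by rewrite R0; constructor.
by rewrite RS; apply: eval_PrimRecS IHi (sP (_, _, _)).
Qed.

Lemma recursive_mu F (S : nat -> T -> nat) :
  recursive (fun p : nat * T => p.1 :: env p.2) (fun p => S p.1 p.2) ->
  (forall x, S (F x) x = 0) -> (forall x i, i < F x -> 0 < S i x) ->
  recursive env F.
Proof.
case=> s sP S0 S_gt0; exists (Mu s) => x.
apply: (@eval_Mu _ _ _ (fun i => (S i x).-1)) => [i /S_gt0 Si|].
  by rewrite prednK //; apply: (sP (_, _)).
by rewrite -[X in eval _ _ X](S0 x); apply: (sP (_, _)).
Qed.

End Closure.

Lemma recursive_primrec1 (R : nat -> nat) (S : nat -> nat -> nat) :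
  (forall i, R i.+1 = S i (R i)) ->
  recursive (fun p => [:: p.1; p.2]) (fun p => S p.1 p.2) ->
  recursive (fun i => [:: i]) R.
Proof.
move=> RS [s sP].
have [||||f fP] := @recursive_primrec unit (fun=> [::]) nat id
  (fun i _ => R i) (fun=> R 0) (fun i j _ => S i j) => //.
- exact: recursive_const.
- by exists s => -[[i j] x]; apply: (sP (_, _)).
by exists f => i; apply: (fP (_, tt)).
Qed.

Lemma recursive_primrec2 (R : nat -> nat -> nat) (B : nat -> nat)
    (S : nat -> nat -> nat -> nat) :
  (forall x, R 0 x = B x) -> (forall i x, R i.+1 x = S i (R i x) x) ->
  recursive (fun x => [:: x]) B ->
  recursive (fun p => [:: p.1.1; p.1.2; p.2]) (fun p => S p.1.1 p.1.2 p.2) ->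
  recursive (fun p => [:: p.1; p.2]) (fun p => R p.1 p.2).
Proof. exact: (@recursive_primrec _ _ _ id). Qed.

Lemma recursive_add T (env : T -> seq nat) (F G : T -> nat) :
  recursive env F -> recursive env G -> recursive env (fun x => F x + G x).
Proof.
apply: (recursive_comp2 (c1 := id) (c2 := id) (h := addn)).
apply: (@recursive_primrec2 addn id (fun i j x => j.+1)) => //.
  exact: (recursive_nth _ 0).
exact: recursive_succ (recursive_nth _ 1).
Qed.

Lemma recursive_mul T (env : T -> seq nat) (F G : T -> nat) :
  recursive env F -> recursive env G -> recursive env (fun x => F x * G x).
Proof.
apply: (recursive_comp2 (c1 := id) (c2 := id) (h := muln)).
apply: (@recursive_primrec2 muln (fun=> 0) (fun i j x => x + j)) => //.
  exact: recursive_const.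
exact: recursive_add (recursive_nth _ 2) (recursive_nth _ 1).
Qed.

Lemma recursive_pred T (env : T -> seq nat) (F : T -> nat) :
  recursive env F -> recursive env (fun x => (F x).-1).
Proof.
apply: (@recursive_comp1 _ _ _ id predn).
apply: (@recursive_primrec1 _ (fun i _ => i)) => //.
exact: (recursive_nth _ 0).
Qed.

Section Comparison.
Variables (T : Type) (env : T -> seq nat).
Implicit Types (F G H : T -> nat) (P Q : T -> bool).

Lemma recursive_sub F G :
  recursive env F -> recursive env G -> recursive env (fun x => F x - G x).
Proof.
move=> rF rG; apply: (recursive_comp2 (c1 := id) (c2 := id) (h := fun x y => y - x))
  rG rF.
apply: (@recursive_primrec2 (fun x y => y - x) id (fun i j x => j.-1)).
- exact: subn0.
- by move=> i x; rewrite subnS.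
- exact: (recursive_nth _ 0).
exact: recursive_pred (recursive_nth _ 1).
Qed.

Lemma recursive_exp2 F : recursive env F -> recursive env (fun x => 2 ^ F x).
Proof.
apply: (@recursive_comp1 _ _ _ id (expn 2)).
apply: (@recursive_primrec1 _ (fun _ j => j + j)) => [i|].
  by rewrite expnS mul2n addnn.
by apply: recursive_add; exact: (recursive_nth _ 1).
Qed.

Lemma recursive_neg P :
  recursive_bool env P -> recursive_bool env (fun x => ~~ P x).
Proof.
move=> rP; apply: recursive_ext (recursive_sub (recursive_const _ 1) rP).
by move=> x; case: (P x).
Qed.

Lemma recursive_and P Q :
  recursive_bool env P -> recursive_bool env Q ->
  recursive_bool env (fun x => P x && Q x).
Proof.
move=> rP rQ; apply: recursive_ext (recursive_mul rP rQ) => x.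
by case: (P x); case: (Q x).
Qed.

Lemma recursive_or P Q :
  recursive_bool env P -> recursive_bool env Q ->
  recursive_bool env (fun x => P x || Q x).
Proof.
move=> rP rQ; have := recursive_neg
  (recursive_and (recursive_neg rP) (recursive_neg rQ)).
by apply: recursive_ext => x; case: (P x); case: (Q x).
Qed.

Lemma recursive_eq0 F : recursive env F -> recursive_bool env (fun x => F x == 0).
Proof.
move=> rF; apply: recursive_ext (recursive_sub (recursive_const _ 1) rF) => x.
by case: (F x).
Qed.

Lemma recursive_leq F G :
  recursive env F -> recursive env G ->
  recursive_bool env (fun x => F x <= G x).
Proof. by move=> rF rG; apply/recursive_eq0/recursive_sub. Qed.

Lemma recursive_eq F G :
  recursive env F -> recursive env G ->
  recursive_bool env (fun x => F x == G x).
Proof.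
move=> rF rG; have := recursive_and (recursive_leq rF rG) (recursive_leq rG rF).
by apply: recursive_ext => x; rewrite eqn_leq.
Qed.

Lemma recursive_if P F G :
  recursive_bool env P -> recursive env F -> recursive env G ->
  recursive env (fun x => if P x then F x else G x).
Proof.
move=> rP rF rG.
have := recursive_add (recursive_mul rP rF) (recursive_mul (recursive_neg rP) rG).
by apply: recursive_ext => x; case: (P x); rewrite /= ?mul1n ?mul0n ?addn0.
Qed.

End Comparison.

Section Division.
Variables (T : Type) (env : T -> seq nat).
Implicit Types (F G H : T -> nat) (P Q : T -> bool).

Lemma recursive_divn F G :
  recursive env F -> recursive env G -> recursive env (fun x => F x %/ G x).
Proof.
apply: (recursive_comp2 (c1 := id) (c2 := id) (h := divn)).
apply: (@recursive_mu _ _ _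
  (* the least k with x < (k + 1) y; for y = 0 it must be 0, as x %/ 0 is *)
  (fun k p => if p.2 == 0 then 0 else p.1.+1 - k.+1 * p.2)).
- apply: recursive_if; first exact: recursive_eq0 (recursive_nth _ 2).
    exact: recursive_const.
  apply: recursive_sub; first exact: recursive_succ (recursive_nth _ 1).
  apply: recursive_mul; first exact: recursive_succ (recursive_nth _ 0).
  exact: (recursive_nth _ 2).
- case=> x [|y] //=; apply/eqP; rewrite subn_eq0.
  by rewrite {1}(divn_eq x y.+1) mulSn addnC ltn_add2r ltn_pmod.
case=> x [|y] /= i; first by rewrite divn0.
by rewrite leq_divRL // subn_gt0 ltnS.
Qed.

Lemma recursive_modn F G :
  recursive env F -> recursive env G -> recursive env (fun x => F x %% G x).
Proof.
move=> rF rG.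
have := recursive_sub rF (recursive_mul (recursive_divn rF rG) rG).
by apply: recursive_ext => x; rewrite {1}(divn_eq (F x) (G x)) addKn.
Qed.

Lemma recursive_half F : recursive env F -> recursive env (fun x => (F x)./2).
Proof.
move=> rF; apply: recursive_ext (recursive_divn rF (recursive_const _ 2)) => x.
by rewrite divn2.
Qed.

Lemma recursive_odd F :
  recursive env F -> recursive_bool env (fun x => odd (F x)).
Proof.
move=> rF; apply: recursive_ext (recursive_modn rF (recursive_const _ 2)) => x.
by rewrite modn2.
Qed.

Lemma recursive_double F : recursive env F -> recursive env (fun x => (F x).*2).
Proof.
by move=> rF; apply: recursive_ext (recursive_add rF rF) => x; rewrite addnn.
Qed.

End Division.

Lemma recursive_logn2 T (env : T -> seq nat) F :
  recursive env F -> recursive env (fun x => logn 2 (F x)).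
Proof.
apply: (@recursive_comp1 _ _ _ id (logn 2)).
apply: (@recursive_mu _ _ _
  (* the least k such that 2 ^ (k + 1) does not divide x; 0 if x = 0 *)
  (fun k x => if x == 0 then 0 else x %% 2 ^ k.+1 == 0 : nat)).
- apply: recursive_if; first exact: recursive_eq0 (recursive_nth _ 1).
    exact: recursive_const.
  apply: recursive_eq0; apply: recursive_modn; first exact: (recursive_nth _ 1).
  exact: recursive_exp2 (recursive_succ (recursive_nth _ 0)).
- case=> //= x; apply/eqP; rewrite eqb0; apply/negP => /eqP dvd_x.
  have : 2 ^ (logn 2 x.+1).+1 %| x.+1 by apply/eqP.
  by rewrite pfactor_dvdn // ltnn.
case=> [|x] i; first by rewrite logn0.
rewrite /=.
by rewrite -pfactor_dvdn // /dvdn => ->.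
Qed.

Lemma recursive_sum T (env : T -> seq nat) I (s : seq I) (F : I -> T -> nat) :
  (forall i, recursive env (F i)) ->
  recursive env (fun x => \sum_(i <- s) F i x).
Proof.
move=> rF; elim: s => [|i s IHs].
  by apply: recursive_ext (recursive_const _ 0) => x; rewrite big_nil.
by apply: recursive_ext (recursive_add (rF i) IHs) => x; rewrite big_cons.
Qed.

(** A left fold over a list is computed by recursion on a bound for its length,
reading at stage i the head of the list with i elements dropped; as every list
is shorter than its code, the code itself serves as the bound. *)
Section Fold.
Variables (X Y : Type) (codeX : seq X -> nat) (codeY : Y -> nat).
Variables (step : Y -> X -> Y) (y0 : Y).

Hypothesis size_codeX : forall s, size s <= codeX s.
Hypothesis recursive_behead :
  recursive (fun s => [:: codeX s]) (fun s => codeX (behead s)).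
Hypothesis recursive_step :
  recursive (fun p => [:: codeX p.1; codeY p.2])
    (fun p => codeY (if p.1 is x :: _ then step p.2 x else p.2)).

Let recursive_drop :
  recursive (fun p => [:: p.1; codeX p.2]) (fun p => codeX (drop p.1 p.2)).
Proof.
apply: (@recursive_primrec _ (fun s => [:: codeX s]) _ codeX
  (fun i s => drop i s) id (fun i t s => behead t)).
- by move=> s; rewrite drop0.
- by move=> i s; elim: s i => [|x s IHs] [|i] //=; rewrite drop0.
- exact: (recursive_nth _ 0).
apply: (recursive_comp1 (f1 := fun p => p.1.2) recursive_behead).
exact: (recursive_nth _ 1).
Qed.

Lemma recursive_foldl :
  recursive (fun s => [:: codeX s]) (fun s => codeY (foldl step y0 s)).
Proof.
have: recursive (fun p => [:: p.1; codeX p.2])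
    (fun p => codeY (foldl step y0 (take p.1 p.2))).
  apply: (@recursive_primrec _ (fun s => [:: codeX s]) _ codeY
    (fun i s => foldl step y0 (take i s)) (fun=> y0)
    (fun i y s => if drop i s is x :: _ then step y x else y)).
  - by move=> s; rewrite take0.
  - move=> i s; rewrite -addn1 takeD foldl_cat.
    by case: (drop i s) => [|x t] //=; rewrite take0.
  - exact: recursive_const.
  apply: (recursive_comp2 (c1 := codeX) (c2 := codeY)
     (h := fun s y => codeY (if s is x :: _ then step y x else y))
     (f1 := fun p => drop p.1.1 p.2) (f2 := fun p => p.1.2)).
  - exact: recursive_step.
  - apply: (recursive_comp2 (c1 := id) (c2 := codeX)
      (h := fun i s => codeX (drop i s))
      (f1 := fun p : nat * Y * seq X => p.1.1) (f2 := snd) recursive_drop).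
      exact: (recursive_nth _ 0).
    exact: (recursive_nth _ 2).
  exact: (recursive_nth _ 1).
move=> rec_fold.
have := recursive_comp2 (c1 := id) (c2 := codeX) (f1 := codeX) (f2 := id)
  (h := fun i s => codeY (foldl step y0 (take i s))) rec_fold
  (recursive_nth (fun s => [:: codeX s]) 0) (recursive_nth _ 0).
by apply: recursive_ext => s; rewrite take_oversize.
Qed.

End Fold.

(** * Word automata decide recursive languages *)

Section WordAutomaton.
Variables (A : finType) (Y : Type) (codeY : Y -> nat).
Variables (act : Y -> letter A -> Y) (y0 : Y) (accept : pred Y).

Lemma card_letter_gt0 (x : letter A) : 0 < #|letter A|.
Proof. by apply/card_gt0P; exists x. Qed.

Lemma size_word_code (w : word A) : size w <= word_code w.
Proof.
elim: w => //= x w IHw; rewrite addSn ltnS (leq_trans IHw) //.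
by rewrite (leq_trans _ (leq_addl _ _)) // leq_pmull // card_letter_gt0.
Qed.

Lemma recursive_word_behead :
  recursive (fun w : word A => [:: word_code w]) (fun w => word_code (behead w)).
Proof.
have := recursive_divn
  (recursive_pred (recursive_nth (fun w : word A => [:: word_code w]) 0))
  (recursive_const _ #|letter A|).
apply: recursive_ext => -[|x w] /=; first by rewrite div0n.
rewrite addnC mulnC divnMDl ?(card_letter_gt0 x) //.
by rewrite divn_small ?addn0 // ltn_ord.
Qed.

Hypothesis recursive_act :
  forall x, recursive (fun y => [:: codeY y]) (fun y => codeY (act y x)).

(** The alphabet being finite, the action of the first letter is a sum over all
letters in which the other terms are multiplied by 0. *)
Lemma recursive_act_head :
  recursive (fun p => [:: word_code p.1; codeY p.2])
    (fun p => codeY (if p.1 is x :: _ then act p.2 x else p.2)).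
Proof.
set env := fun p : word A * Y => _.
have rec_c : recursive env (fun p => word_code p.1) by exact: (recursive_nth _ 0).
have rec_y : recursive env (fun p => codeY p.2) by exact: (recursive_nth _ 1).
have rec_sum := recursive_sum (enum (letter A)) (fun x => recursive_mul
  (recursive_eq
    (recursive_modn (recursive_pred rec_c) (recursive_const _ #|letter A|))
    (recursive_const _ (enum_rank x)))
  (recursive_comp1 (recursive_act x) rec_y)).
apply: recursive_ext (recursive_if (recursive_eq0 rec_c) rec_y rec_sum).
case=> [[|x w] y] //=.
rewrite addnC mulnC modnMDl modn_small ?ltn_ord // big_enum /= (bigD1 x) //=.
rewrite eqxx mul1n big1 ?addn0 // => z; rewrite eq_sym => /negPf zx.
by rewrite (inj_eq val_inj) (inj_eq enum_rank_inj) zx.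
Qed.

Theorem word_decidable_automaton (L : set (word A)) :
  recursive_bool (fun y => [:: codeY y]) accept ->
  (forall w, L w <-> accept (foldl act y0 w)) -> word_decidable L.
Proof.
move=> rec_acc LP.
have [f fP] := recursive_comp1 (h := fun y => accept y) rec_acc
  (recursive_foldl (codeY := codeY) (step := act) y0 size_word_code
  recursive_word_behead recursive_act_head).
by exists f => w; split=> [/LP | /LP/negP/negPf] acc; have := fP w; rewrite acc.
Qed.

End WordAutomaton.

(** * Recursive functions of lists and integers *)

Local Notation code := CodeSeq.code.

Section Lists.
Variables (T : Type) (env : T -> seq nat).

Lemma recursive_code_cons (F : T -> nat) (S : T -> seq nat) :
  recursive env F -> recursive env (fun x => code (S x)) ->
  recursive env (fun x => code (F x :: S x)).
Proof.
move=> rF rS; apply: recursive_mul (recursive_exp2 rF) _.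
exact: recursive_succ (recursive_double rS).
Qed.

Lemma logn2_code x s : logn 2 (code (x :: s)) = x.
Proof.
rewrite /= lognM ?expn_gt0 // pfactorK // lognE /= dvdn2 /= odd_double.
by rewrite addn0.
Qed.

Lemma recursive_code_head (S : T -> seq nat) :
  recursive env (fun x => code (S x)) -> recursive env (fun x => head 0 (S x)).
Proof.
move=> rS; apply: recursive_ext (recursive_logn2 rS) => x.
by case: (S x) => [|y s]; rewrite ?logn2_code.
Qed.

Lemma recursive_code_behead (S : T -> seq nat) :
  recursive env (fun x => code (S x)) ->
  recursive env (fun x => code (behead (S x))).
Proof.
move=> rS.
have := recursive_half (recursive_divn rS (recursive_exp2 (recursive_logn2 rS))).
apply: recursive_ext => x; case: (S x) => [|y s]; first by rewrite div0n.
by rewrite logn2_code /= mulKn ?expn_gt0 //= uphalf_double.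
Qed.

Lemma code_eq0 s : (code s == 0) = nilp s.
Proof. by case: s => //= x s; rewrite muln_eq0 expn_eq0. Qed.

Lemma size_code s : size s <= code s.
Proof.
elim: s => //= x s IHs; apply: leq_trans (leq_pmull _ (expn_gt0 2 x)) => /=.
by rewrite ltnS -addnn (leq_trans IHs) ?leq_addr.
Qed.

End Lists.

Section Integers.
Local Open Scope ring_scope.

Definition int_code (z : int) : nat :=
  match z with Posz k => k.*2 | Negz k => k.*2.+1 end.

Definition recursive_int T (env : T -> seq nat) (F : T -> int) : Prop :=
  recursive env (fun x => int_code (F x)).

Variables (T : Type) (env : T -> seq nat).
Implicit Types F G : T -> int.

Lemma recursive_int_sub (P Q : T -> nat) :
  recursive env P -> recursive env Q ->
  recursive_int env (fun x => (P x)%:Z - (Q x)%:Z).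
Proof.
move=> rP rQ.
have := recursive_if (recursive_leq rQ rP)
  (recursive_double (recursive_sub rP rQ))
  (recursive_succ (recursive_double (recursive_pred (recursive_sub rQ rP)))).
apply: recursive_ext => x; case: leqP => [QP | PQ]; first by rewrite subzn.
have -> : (P x)%:Z - (Q x)%:Z = Negz (Q x - P x).-1 by lia.
by [].
Qed.

(** Differences of natural numbers compute integer operations without a case
analysis on signs; their code is recovered by [recursive_int_sub]. *)
Lemma recursive_int_parts F : recursive_int env F ->
  exists P Q : T -> nat, [/\ recursive env P, recursive env Q &
    forall x, F x = (P x)%:Z - (Q x)%:Z].
Proof.
move=> rF; have rh := recursive_half rF.
exists (fun x => if odd (int_code (F x)) then 0%N else (int_code (F x))./2).
exists (fun x => if odd (int_code (F x)) then (int_code (F x))./2.+1 else 0%N).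
have ro := recursive_odd rF; split; first 1 last.
- exact: recursive_if ro (recursive_succ rh) (recursive_const _ 0).
- move=> x; case: (F x) => k /=; rewrite odd_double /=.
    by rewrite doubleK subr0.
  by rewrite uphalf_double NegzE sub0r.
exact: recursive_if ro (recursive_const _ 0) rh.
Qed.

Lemma recursive_int_add F G :
  recursive_int env F -> recursive_int env G ->
  recursive_int env (fun x => F x + G x).
Proof.
move=> /recursive_int_parts[P [Q [rP rQ FE]]].
move=> /recursive_int_parts[P' [Q' [rP' rQ' GE]]].
apply: recursive_ext
  (recursive_int_sub (recursive_add rP rP') (recursive_add rQ rQ')).
by move=> x; rewrite FE GE !PoszD opprD addrACA.
Qed.

Lemma recursive_int_opp F :
  recursive_int env F -> recursive_int env (fun x => - F x).
Proof.
move=> /recursive_int_parts[P [Q [rP rQ FE]]].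
by apply: recursive_ext (recursive_int_sub rQ rP) => x; rewrite FE opprB.
Qed.

Lemma recursive_int_const k : recursive_int env (fun=> k).
Proof. exact: recursive_const. Qed.

Lemma recursive_int_mul F G :
  recursive_int env F -> recursive_int env G ->
  recursive_int env (fun x => F x * G x).
Proof.
move=> /recursive_int_parts[P [Q [rP rQ FE]]].
move=> /recursive_int_parts[P' [Q' [rP' rQ' GE]]].
have := recursive_int_sub
  (recursive_add (recursive_mul rP rP') (recursive_mul rQ rQ'))
  (recursive_add (recursive_mul rP rQ') (recursive_mul rQ rP')).
apply: recursive_ext => x; congr int_code; rewrite FE GE !PoszD !PoszM; ring.
Qed.

Lemma recursive_int_div F d :
  recursive_int env F -> recursive_int env (fun x => (F x %/ d)%Z).
Proof.
wlog [k ->] : d / exists k, d = Posz k => [IH rF|].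
  case: d => k; first by apply: IH => //; exists k.
  have := recursive_int_opp (IH k.+1 (ex_intro _ k.+1 erefl) rF).
  by apply: recursive_ext => x; rewrite NegzE divzN.
case: k => [_|k /recursive_int_parts[P [Q [rP rQ FE]]]].
  by apply: recursive_ext (recursive_const _ 0) => x; rewrite divz0.
have := recursive_int_sub (recursive_divn
   (recursive_add rP (recursive_mul rQ (recursive_const _ k)))
   (recursive_const _ k.+1)) rQ.
apply: recursive_ext => x; congr int_code.
(* P - Q = (P + Q * k) - Q * (k + 1), with nonnegative first term *)
rewrite FE -divz_nat.
have -> : (P x)%:Z - (Q x)%:Z = (- (Q x)%:Z) * k.+1 + (P x + Q x * k)%N by lia.
by rewrite divzMDl // addrC.
Qed.

Lemma recursive_int_mod F d :
  recursive_int env F -> recursive_int env (fun x => (F x %% d)%Z).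
Proof.
move=> rF; have := recursive_int_add rF (recursive_int_opp
  (recursive_int_mul (recursive_int_div d rF) (recursive_int_const d))).
by apply: recursive_ext => x; congr int_code;
  rewrite {1}(divz_eq (F x) d) addrAC subrr add0r.
Qed.

Lemma recursive_int_eq0 F :
  recursive_int env F -> recursive_bool env (fun x => F x == 0).
Proof.
by move/recursive_eq0; apply: recursive_ext => x; case: (F x) => [[|k]|k].
Qed.

Lemma recursive_int_ge0 F :
  recursive_int env F -> recursive_bool env (fun x => 0 <= F x).
Proof.
move/recursive_odd/recursive_neg; apply: recursive_ext => x.
by case: (F x) => k /=; rewrite odd_double.
Qed.

End Integers.

(** * The action of letters on Britton normal forms *)

Section NormalForms.
Local Open Scope ring_scope.
Variables (m n : int) (eps : bool).

Definition cell : Type := (int * bool)%type.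

(** The stack lists the factors a^r t^s from right to left, so that its head is
next to the last exponent, where multiplication takes place. *)
Definition state : Type := (seq cell * int)%type.

Implicit Types (s : bool) (stk : seq cell) (st : state).

(** Here true stands for t^-1, as in letters; the powers of a that commute past
t^s from the left are those with exponent in [edge s] Z, and they come out with
exponent in [edge (~~ s)] Z. *)
Definition edge s : int := if s then m else n.

(** The order of a up to sign, with 0 for infinite order: if m = 0 the relator
gives a^n = 1, and symmetrically. *)
Definition order : int := if m == 0 then n else if n == 0 then m else 0.

Definition shift (k : int) st : state := (st.1, ((st.2 + k) %% order)%Z).

Definition top_is s stk : bool := if stk is c :: _ then c.2 == s else false.

Definition turn s st : state :=
  let r := (st.2 %% edge s)%Z in
  let e := edge (~~ s) * (st.2 %/ edge s)%Z in
  if (r == 0) && top_is (~~ s) st.1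
  then (behead st.1, (head (0, s) st.1).1 + e) else ((r, s) :: st.1, e).

(** The exponents of a normal form count occurrences of the letter [(bs_a, eps)]:
as a and a^-1 satisfy the same relation, either may serve as the generator of
the base group. *)
Definition act st (x : letter bs_letter) : state :=
  if x.1 is bs_a then shift (if x.2 == eps then 1 else -1) st else turn x.2 st.

Fixpoint reduced stk : bool :=
  if stk is c :: stk' then
    [&& (c.1 %% edge c.2)%Z == c.1, (c.1 %% order)%Z == c.1,
      ~~ ((c.1 == 0) && top_is (~~ c.2) stk') & reduced stk']
  else true.

Definition normal st : bool := reduced st.1 && ((st.2 %% order)%Z == st.2).

(** So nothing is carried across t^s when a has finite order: a quotient by the
edge 0 is 0, and a quotient by the other edge gets multiplied by 0.  This is why
reducing exponents modulo the order does not interfere with [turn]. *)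
Lemma order_neq0_edge s : order != 0 ->
  (edge s = 0 /\ edge (~~ s) = order) \/ (edge s = order /\ edge (~~ s) = 0).
Proof.
rewrite /order /edge; case: (eqVneq m 0) => [->|m0]; first by case: s; auto.
by case: (eqVneq n 0) => [->|n0]; case: s; auto.
Qed.

Lemma order_eq0_edge s : order = 0 -> edge s = 0 -> edge (~~ s) = 0.
Proof.
rewrite /order /edge; case: (eqVneq m 0) => [->|m0]; first by case: s.
by case: (eqVneq n 0) m0 => [->|n0] /eqP m0; case: s => //= _ /eqP;
  rewrite (negPf n0).
Qed.

Lemma divz_mod0 (e d : int) : ((e %% d)%Z %/ d)%Z = 0.
Proof.
case: (eqVneq d 0) => [->|d0]; first by rewrite divz0.
by rewrite divz_small // modz_ge0 // ltz_mod.
Qed.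

Lemma order_carry s e : order != 0 -> (e %% order)%Z = e ->
  edge (~~ s) * (e %/ edge s)%Z = 0.
Proof.
move=> N0 eN; case: (order_neq0_edge s N0) => -[-> ->]; last by rewrite mul0r.
by rewrite divz0 mulr0.
Qed.

Lemma edge_quotient0 s e : (e %% order)%Z = e -> edge (~~ s) = 0 ->
  (e %/ edge s)%Z = 0.
Proof.
move=> eN s0; case: (eqVneq order 0) => [N0|N0].
  by have := order_eq0_edge N0 s0; rewrite negbK => ->; rewrite divz0.
case: (order_neq0_edge s N0) => -[-> Ns]; first by rewrite divz0.
by rewrite -eN divz_mod0.
Qed.

Lemma edge_mod s r q :
  (r %% edge s)%Z = r -> ((r + edge s * q) %% edge s)%Z = r.
Proof. by move=> rs; rewrite addrC mulrC modzMDl. Qed.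

Lemma edge_div s r q : (r %% edge s)%Z = r -> (edge s = 0 -> q = 0) ->
  ((r + edge s * q) %/ edge s)%Z = q.
Proof.
move=> rs q0; case: (eqVneq (edge s) 0) => [s0|s0].
  by rewrite s0 divz0 q0.
by rewrite addrC mulrC divzMDl // -rs divz_mod0 addr0.
Qed.

Lemma normal_shift k st : normal st -> normal (shift k st).
Proof. by case/andP=> red _; rewrite /normal red /= modz_mod. Qed.

Lemma order_mod_edge s e : (e %% order)%Z = e ->
  ((e %% edge s)%Z %% order)%Z = (e %% edge s)%Z.
Proof.
move=> eN; case: (eqVneq order 0) => [->|N0]; first by rewrite modz0.
case: (order_neq0_edge s N0) => -[-> _]; first by rewrite modz0.
by rewrite modz_mod.
Qed.

Lemma normal_turn s st : normal st -> normal (turn s st).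
Proof.
case: st => stk e /andP[/= red /eqP eN]; rewrite /turn /=.
have carryN r : (r %% order)%Z = r ->
    ((r + edge (~~ s) * (e %/ edge s)%Z) %% order)%Z
      = r + edge (~~ s) * (e %/ edge s)%Z.
  move=> rN; case: (eqVneq order 0) => [->|N0]; first by rewrite modz0.
  by rewrite order_carry // addr0.
case: ifP => [/andP[_]|pop].
  case: stk red => // -[r s'] stk /= /and4P[_ /eqP rN _ red] _.
  by rewrite /normal red /= carryN.
rewrite /normal /= pop red modz_mod eqxx order_mod_edge // eqxx /=.
by rewrite -{2}[edge _ * _]add0r -carryN ?mod0z // add0r.
Qed.

Lemma normal_act st x : normal st -> normal (act st x).
Proof.
by case: x => -[] s; rewrite /act /=; [exact: normal_shift | exact: normal_turn].
Qed.

(** A turn that pushes is undone by one that pops.  Conversely, after a turn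
that pops the cell (r, -s), dividing the last exponent gives back r, and since
the stack was reduced the opposite turn pushes this cell again. *)
Lemma turnK s st : normal st -> turn (~~ s) (turn s st) = st.
Proof.
case: st => stk e /andP[/= red /eqP eN]; rewrite {2}/turn /=.
have q0 : edge (~~ s) = 0 -> (e %/ edge s)%Z = 0 by exact: edge_quotient0.
case: ifP => [/andP[/eqP r0]|pop].
  case: stk red => // -[r s'] stk /= /and4P[/eqP rs _ top red] /eqP ss'.
  move: rs top; rewrite {}ss' => rs /negPf top.
  rewrite /turn /= edge_mod // top edge_div // negbK.
  by congr (_, _); rewrite [RHS](divz_eq e (edge s)) r0 addr0 mulrC.
rewrite /turn /=.
have m0 : (edge (~~ s) * (e %/ edge s)%Z %% edge (~~ s))%Z = 0.
  by rewrite -[edge _ * _]add0r edge_mod ?mod0z.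
have dq : (edge (~~ s) * (e %/ edge s)%Z %/ edge (~~ s))%Z = (e %/ edge s)%Z.
  by rewrite -[edge _ * _]add0r edge_div ?mod0z.
by rewrite m0 dq negbK !eqxx /= addrC mulrC -divz_eq.
Qed.

Lemma shiftD j k st : shift j (shift k st) = shift (k + j) st.
Proof. by rewrite /shift /= modzDml addrA. Qed.

Lemma shift0 st : normal st -> shift 0 st = st.
Proof. by case: st => stk e /andP[_ /eqP eN]; rewrite /shift /= addr0 eN. Qed.

(** The relation a^(d k) t^s = t^s a^(d' k), where d and d' are the two edges, on
normal forms; with [turnK] it makes the relator act trivially. *)
Lemma turn_shift s k st : normal st ->
  turn s (shift (edge s * k) st) = shift (edge (~~ s) * k) (turn s st).
Proof.
move=> nst; case: (eqVneq order 0) => [N0|N0]; last first.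
  have shift_edge s' st' : normal st' -> shift (edge s' * k) st' = st'.
    case: st' => stk e /andP[_ /eqP /= eN]; rewrite /shift /=.
    case: (order_neq0_edge s' N0) => -[-> _]; first by rewrite mul0r addr0 eN.
    by rewrite addrC mulrC modzMDl eN.
  by rewrite !shift_edge //; exact: normal_turn.
case: (eqVneq (edge s) 0) => [s0|s0].
  by rewrite (order_eq0_edge N0 s0) s0 !mul0r !shift0 //; exact: normal_turn.
case: st {nst} => stk e; rewrite /shift /turn /= N0 !modz0.
rewrite addrC [edge s * k]mulrC modzMDl divzMDl // mulrDr.
by case: ifP => _ /=; congr (_, _); ring.
Qed.

Lemma actK st x : normal st -> act (act st x) (letter_inv x) = st.
Proof.
case: x => -[] s nst; rewrite /act /=; last exact: turnK.
rewrite shiftD; have -> : (if s == eps then 1 else -1)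
    + (if ~~ s == eps then 1 else -1) = 0 :> int by case: s; case: eps.
exact: shift0.
Qed.

Lemma normal_foldl st w : normal st -> normal (foldl act st w).
Proof. by elim: w st => //= x w IHw st nst; apply/IHw/normal_act. Qed.

Lemma foldl_letter_pow st k : normal st ->
  foldl act st (letter_pow (bs_a, false) k)
    = shift (k * (if eps then -1 else 1)) st.
Proof.
move=> nst; have foldl_nseq i c : foldl act st (nseq i (bs_a, c))
    = shift (i%:Z * (if c == eps then 1 else -1)) st.
  elim: i => [|i IHi] in st nst *; first by rewrite mul0r shift0.
  rewrite /= IHi ?normal_act // /act /= shiftD; congr shift.
  by rewrite intS mulrDl mul1r.
case: k => i; rewrite /letter_pow ?foldl_nseq; congr shift; first by case: eps.
by rewrite NegzE; case: eps => /=; ring.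
Qed.

Lemma foldl_relator st : normal st -> foldl act st (BS_relator m n) = st.
Proof.
move=> nst; rewrite /BS_relator !foldl_cat [foldl _ st _]/= [foldl _ _ [:: _]]/=.
rewrite !foldl_letter_pow ?(normal_act, normal_shift) //.
set sg := if eps then _ else _.
rewrite /act /=.
have -> : shift (m * sg) (turn false st)
    = turn false (shift (edge false * sg) st).
  by rewrite turn_shift.
rewrite -[true]/(~~ false) turnK ?normal_shift //.
rewrite shiftD mulNr addrN.
exact: shift0.
Qed.

Lemma foldl_pres_eq st v w : normal st -> pres_eq (BS_relator m n) v w ->
  foldl act st v = foldl act st w.
Proof.
move=> nst vw; elim: vw => // [u v' w' _ -> _ ->|u v' x|u v'] //.
  by rewrite !foldl_cat /= actK // normal_foldl.
rewrite (foldl_cat _ _ u) (foldl_cat _ _ (BS_relator m n)).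
by rewrite foldl_relator ?normal_foldl // -foldl_cat.
Qed.

End NormalForms.

(** * Normal forms evaluate to the elements they represent *)

Section IntegerPowers.
Local Open Scope group_scope.
Variable G : groupType.
Implicit Types (g h t : G) (j k : int).

Definition zpow g k : G :=
  match k with Posz i => g ^+ i | Negz i => g ^- i.+1 end.

Lemma zpow0 g : zpow g 0%R = 1. Proof. by []. Qed.

Lemma zpowS g k : zpow g (k + 1)%R = zpow g k * g.
Proof.
case: k => [i|[|i]]; first by rewrite -PoszD addn1 /= expgSr.
  by rewrite [zpow _ _]expg0 /= expg1 mulVg.
have -> : (Negz i.+1 + 1 = Negz i)%R by lia.
by rewrite /zpow [in RHS]expgS invgM mulgVK.
Qed.

Lemma zpowD g j k : zpow g (j + k)%R = zpow g j * zpow g k.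
Proof.
elim/int_ind: k => [|i IHi|i IHi]; first by rewrite addr0 zpow0 mulg1.
  by rewrite -addn1 PoszD addrA !zpowS IHi mulgA.
have Sz : zpow g (- i%:Z)%R = zpow g (- i.+1%:Z)%R * g.
  by rewrite -zpowS; congr zpow; lia.
apply: (mulIg g); rewrite -mulgA -Sz -IHi -zpowS; congr zpow; lia.
Qed.

Lemma zpowN g k : zpow g (- k)%R = (zpow g k)^-1.
Proof. by apply: (mulIg (zpow g k)); rewrite -zpowD addNr mulVg. Qed.

Lemma zpowM g j k : zpow g (j * k)%R = zpow (zpow g j) k.
Proof.
elim/int_ind: k => [|i IHi|i IHi]; first by rewrite mulr0.
  by rewrite -addn1 PoszD zpowS mulrDr mulr1 zpowD IHi.
have -> : (j * - i.+1%:Z = j * - i%:Z - j)%R by lia.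
rewrite zpowD IHi (zpowN g j); apply: (mulIg (zpow g j)); rewrite mulgVK -zpowS.
congr zpow; lia.
Qed.

Lemma zpowV g k : zpow g^-1 k = zpow g (- k)%R.
Proof.
have -> : g^-1 = zpow g (-1)%R by rewrite [RHS]/= expg1.
by rewrite -zpowM mulN1r.
Qed.

Lemma zpow_semiconj g h t k : g * t = t * h -> zpow g k * t = t * zpow h k.
Proof.
move=> gt; have E : g = t * h / t by rewrite -gt mulgK.
elim/int_ind: k => [|i IHi|i IHi]; first by rewrite !zpow0 mul1g mulg1.
  by rewrite -addn1 PoszD !zpowS -mulgA gt mulgA IHi mulgA.
have Sz f : zpow f (- i%:Z)%R = zpow f (- i.+1%:Z)%R * f.
  by rewrite -zpowS; congr zpow; lia.
by apply: (mulIg h); rewrite -mulgA -gt mulgA -Sz IHi -mulgA -Sz.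
Qed.

Lemma zpow1 k : zpow 1 k = 1 :> G.
Proof. by rewrite -(zpow0 1) -zpowM mul0r. Qed.

End IntegerPowers.

Section Evaluation.
Local Open Scope group_scope.
Variables (m n : int) (eps : bool).

Local Notation G := (BS m n).
Local Notation cls := (@word_class _ (BS_relator m n)).
Local Notation edge := (edge m n).
Local Notation order := (order m n).
Local Notation act := (act m n eps).

Definition base : G := cls [:: (bs_a, eps)].
Definition stable s : G := cls [:: (bs_t, s)].

Lemma word_class_cat v w : cls (v ++ w) = cls v * cls w.
Proof. by rewrite -pres_mulE. Qed.

Lemma word_classV w : cls (word_inv w) = (cls w)^-1.
Proof. by rewrite -pres_oppE. Qed.

Lemma word_class1 : cls [::] = 1. Proof. by []. Qed.

Lemma stableN s : stable (~~ s) = (stable s)^-1.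
Proof. by rewrite /stable -word_classV. Qed.

Lemma word_class_pow x k : cls (letter_pow x k) = zpow (cls [:: x]) k.
Proof.
have nseqE y i : cls (nseq i y) = cls [:: y] ^+ i.
  by elim: i => // i IHi; rewrite expgS -IHi -word_class_cat.
case: k => i; rewrite /letter_pow nseqE //.
by rewrite -[[:: _]]/(word_inv [:: x]) word_classV expVgn.
Qed.

Lemma base_stable s (k : int) :
  zpow base (edge s * k)%R * stable s = stable s * zpow base (edge (~~ s) * k)%R.
Proof.
pose a := cls [:: (bs_a, false)].
have rel : zpow a n * stable false = stable false * zpow a m.
  have /word_classP := @pres_relator _ (BS_relator m n) [::] [::].
  rewrite cat0s cats0 /BS_relator !word_class_cat !word_class_pow zpowN.
  rewrite -/(stable false) -[cls [:: (bs_t, true)]]/(stable (~~ false)) stableN.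
  rewrite word_class1 mulg1 !mulgA => /divg1_eq <-.
  by rewrite mulgVK.
have relb : zpow base n * stable false = stable false * zpow base m.
  rewrite /base; case: eps => //.
  rewrite -[[:: _]]/(word_inv [:: (bs_a, false)]) word_classV !zpowV.
  by have := zpow_semiconj (-1)%R rel; rewrite -!zpowM !mulrN1.
rewrite !zpowM; apply: zpow_semiconj; case: s => //=.
rewrite -[true]/(~~ false) stableN; apply: (mulgI (stable false)).
by rewrite mulgA -relb mulgK mulVKg.
Qed.

Lemma zpow_base_order (k : int) : zpow base (order * k)%R = 1.
Proof.
rewrite zpowM; suff -> : zpow base order = 1 by rewrite zpow1.
rewrite /order; case: eqP => [m0|_].
  have := base_stable false 1; rewrite !mulr1 [edge (~~ _)]m0 zpow0 mulg1.
  by move=> E; apply: (mulIg (stable false)); rewrite E mul1g.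
case: eqP => // n0.
have := base_stable false 1; rewrite !mulr1 [edge false]n0 zpow0 mul1g.
by move=> E; apply: (mulgI (stable false)); rewrite -E mulg1.
Qed.

Fixpoint stack_val (stk : seq cell) : G :=
  if stk is c :: stk' then stack_val stk' * (zpow base c.1 * stable c.2) else 1.

Definition state_val (st : state) : G := stack_val st.1 * zpow base st.2.

Lemma state_val_shift k st :
  state_val (shift m n k st) = state_val st * zpow base k.
Proof.
rewrite /state_val /= -mulgA -zpowD; set e := (st.2 + k)%R.
rewrite [in RHS](divz_eq e order) [(_ * order)%R]mulrC.
by rewrite (zpowD _ (order * _)) zpow_base_order mul1g.
Qed.

Lemma state_val_turn s st :
  state_val (turn m n s st) = state_val st * stable s.
Proof.
case: st => stk e; rewrite /state_val /turn /=.
move: (e %/ edge s)%Z (e %% edge s)%Z (divz_eq e (edge s)) => q r {e}->.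
rewrite [(q * _ + r)%R]addrC [(q * _)%R]mulrC.
case: ifP => [/andP[/eqP ->]|_] /=; last first.
  by rewrite zpowD -!mulgA base_stable.
case: stk => // -[r' s'] stk /= /eqP ->.
by rewrite add0r zpowD -!mulgA base_stable stableN mulKg.
Qed.

Lemma state_val_act st x : state_val (act st x) = state_val st * cls [:: x].
Proof.
case: x => -[] s; rewrite /act /= ?state_val_turn // state_val_shift.
congr (_ * _); rewrite /base; case: eqVneq => [->|s_eps]; first exact: expg1.
have -> : eps = ~~ s by case: s s_eps; case: eps.
by rewrite [LHS]/= expg1 -word_classV /word_inv /= /letter_inv /= negbK.
Qed.

Lemma state_val_foldl st w :
  state_val (foldl act st w) = state_val st * cls w.
Proof.
elim: w st => [|x w IHw] st /=; first by rewrite word_class1 mulg1.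
by rewrite IHw state_val_act -mulgA -(word_class_cat [:: x]).
Qed.

End Evaluation.

(** * The normal forms of a Magnus submonoid *)

Section Acceptance.
Variables (m n : int) (eps : bool) (X : {set letter bs_letter}).
Hypothesis Xeps : (bs_a, ~~ eps) \in X -> (bs_a, eps) \in X.

Local Notation G := (BS m n).
Local Notation cls := (@word_class _ (BS_relator m n)).
Local Notation edge := (edge m n).
Local Notation order := (order m n).
Local Notation act := (act m n eps).
Local Notation base := (base m n eps).
Local Notation stable := (stable m n).
Local Notation zero_only := ((bs_a, eps) \notin X).
Local Notation both_signs := ((bs_a, ~~ eps) \in X).

(** The exponents in a stack are Euclidean remainders: when m n < 0 both edges are
nonzero, so that they are nonnegative anyway. *)
Definition exponent_ok (r : int) : bool :=
  if zero_only then r == 0%R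
  else [|| (0 <= r)%R, both_signs | (m * n < 0)%R].

Definition cell_ok (c : cell) : bool := ((bs_t, c.2) \in X) && exponent_ok c.1.

Definition last_ok (st : state) : bool :=
  if zero_only then st.2 == 0%R
  else [|| (0 <= st.2)%R, both_signs | (m * n < 0)%R &&
         (~~ nilp st.1 || ((bs_t, false) \in X) && ((bs_t, true) \in X))].

Definition accepted (st : state) : bool := all cell_ok st.1 && last_ok st.

Lemma carry_ge0 (d d' e : int) :
  (0 <= d * d')%R -> (0 <= e)%R -> (0 <= d' * (e %/ d)%Z)%R.
Proof.
move=> dd' e0; case: (ltrgtP d 0%R) => [d0|d0|->]; last by rewrite divz0 mulr0.
  have q0 : (0 <= (e %/ (- d)%R)%Z)%R by rewrite divz_ge0 ?oppr_gt0.
  by rewrite divzN in q0; nia.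
by have : (0 <= (e %/ d)%Z)%R by [rewrite divz_ge0]; nia.
Qed.

Lemma modz_nonneg (e d : int) : (0 <= e)%R -> (0 <= (e %% d)%Z)%R.
Proof.
by move=> e0; case: (eqVneq d 0%R) => [->|d0]; rewrite ?modz0 ?modz_ge0.
Qed.

Lemma edge_edgeN s : (edge s * edge (~~ s) = m * n)%R.
Proof. by case: s; rewrite //= mulrC. Qed.

(** When the base letter but not its inverse is in X and m n < 0, the delicate
case is a turn that pops: it can empty the stack, but the popped letter and
the present one are opposite and both in X, which is the other reason for
accepting a negative last exponent. *)
Lemma accepted_turn s st : (bs_t, s) \in X -> accepted st ->
  accepted (turn m n s st).
Proof.
case: st => stk e sX /andP[/=]; rewrite /accepted /last_ok /turn /=.
case: ifPn => [aX all_ok /eqP ->|/negPn aX all_ok e_ok].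
  rewrite mod0z div0z mulr0 addr0 eqxx /=; case: ifP => [top|_] /=.
    case: stk all_ok top => //= c stk /andP[/andP[_]] c0 -> _ /=.
    by rewrite /exponent_ok aX in c0.
  by rewrite /cell_ok /= sX all_ok /exponent_ok aX eqxx.
set r := (e %% edge s)%Z; set e' := (edge (~~ s) * _)%R.
have eok0 x : exponent_ok x = [|| (0 <= x)%R, both_signs | (m * n < 0)%R].
  by rewrite /exponent_ok aX.
have [aX'|aX'] := boolP both_signs.
  case: ifP => [_|_] /=; rewrite orbT andbT.
    by case: stk all_ok {e_ok} => //= c stk /andP[].
  by rewrite /cell_ok /= eok0 aX' orbT sX.
rewrite (negPf aX') /= in e_ok eok0 *.
have [mn|mn] := boolP (m * n < 0)%R;
  rewrite ?(negPf mn) ?mn /= ?orbF in e_ok eok0 *.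
  case: ifP => [/andP[_]|_] /=; last first.
    by rewrite /cell_ok /= eok0 sX all_ok ?orbT.
  case: stk all_ok e_ok => //= -[r' s'] stk /=.
  case/andP => /andP[s'X _] -> _ /eqP ss'; move: s'X.
  rewrite /= ss' => s'X; apply/orP; right; apply/orP; right.
  by case: (s) sX s'X => /= -> ->.
rewrite -leNgt in mn.
have e'0 : (0 <= e')%R by apply: carry_ge0 => //; rewrite edge_edgeN.
have r0 : (0 <= r)%R by exact: modz_nonneg.
case: ifP => [/andP[_]|_] /=; last by rewrite /cell_ok /= eok0 r0 sX all_ok e'0.
case: stk all_ok {e_ok} => //= c stk /andP[/andP[_]].
rewrite eok0 orbF => c0 -> _ /=.
by rewrite addr_ge0.
Qed.

Lemma accepted_act st x : x \in X -> accepted st -> accepted (act st x).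
Proof.
case: x => -[] s sX; last exact: accepted_turn.
have aX : (bs_a, eps) \in X.
  by have [<- //|s_eps] := eqVneq s eps; apply: Xeps; case: s eps s_eps sX => -[].
rewrite /accepted /last_ok /act /= aX /= => /andP[-> /=].
case/or3P => [e0|->|->]; rewrite ?orbT //.
have [s_eps|s_eps] := eqVneq s eps.
  by rewrite modz_nonneg // addr_ge0.
have -> : (bs_a, ~~ eps) \in X by case: s eps s_eps sX => -[].
by rewrite orbT.
Qed.

Lemma accepted_foldl w st : all (mem X) w -> accepted st ->
  accepted (foldl act st w).
Proof.
elim: w st => //= x w IHw st /andP[xX wX] acc.
by apply: IHw => //; apply: accepted_act.
Qed.

End Acceptance.

Section Submonoid.
Local Open Scope group_scope.
Variables (A : finType) (r : word A) (X : {set letter A}).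

Local Notation gens :=
  [set g | exists2 x, x \in X & g = letter_val (one_relator_gen r) x]%classic.

Lemma letter_valE x : letter_val (one_relator_gen r) x = word_class r [:: x].
Proof. by case: x => a [] //; apply: (pres_oppE r [:: (a, false)]). Qed.

Lemma word_valE w : word_val (one_relator_gen r) w = word_class r w.
Proof.
elim: w => [|x w IHw]; first by rewrite /word_val big_nil.
by rewrite /word_val big_cons -/(word_val _ w) IHw letter_valE; apply: pres_mulE.
Qed.

Lemma submonoid_generated_sub : submonoid (submonoid_generated gens).
Proof.
split=> [M [[M1 _] _] //|x y Kx Ky M sM].
by have [[_ MM] _] := sM; apply: MM; [exact: Kx | exact: Ky].
Qed.

Lemma submonoid_generated_gen x :
  x \in X -> submonoid_generated gens (word_class r [:: x]).
Proof.
by move=> xX M [_]; apply; exists x => //; rewrite letter_valE.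
Qed.

Lemma submonoid_generatedP g : submonoid_generated gens g ->
  exists2 w, all (mem X) w & g = word_class r w.
Proof.
move/(_ [set g | exists2 w, all (mem X) w & g = word_class r w]%classic).
apply; split; last first.
  by move=> _ [x xX ->]; exists [:: x]; rewrite /= ?xX // letter_valE.
split=> [|_ _ [v vX ->] [w wX ->]]; first by exists [::].
by exists (v ++ w); rewrite ?all_cat ?vX // -pres_mulE.
Qed.

End Submonoid.

Section Completeness.
Local Open Scope group_scope.
Variables (m n : int) (eps : bool) (X : {set letter bs_letter}).

Local Notation G := (BS m n).
Local Notation cls := (@word_class _ (BS_relator m n)).
Local Notation edge := (edge m n).
Local Notation base := (base m n eps).
Local Notation stable := (stable m n).

Variable K : set G.
Hypothesis subK : submonoid K.
Hypothesis XK : forall x, x \in X -> K (cls [:: x]).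

Let K1 : K 1 := subK.1.
Let KM x y : K x -> K y -> K (x * y). Proof. exact: subK.2. Qed.

Lemma submonoid_zpow g k : K g -> (0 <= k)%R -> K (zpow g k).
Proof.
case: k => // i Kg _; elim: i => //= i IHi.
by rewrite expgS; apply: KM.
Qed.

Lemma submonoid_zpow_both k :
  (bs_a, eps) \in X -> (bs_a, ~~ eps) \in X -> K (zpow base k).
Proof.
move=> aX aX'; have [k0|/ltW k0] := lerP 0%R k.
  by apply: submonoid_zpow => //; apply: XK.
rewrite -[k]opprK -zpowV; apply: submonoid_zpow; last by rewrite oppr_ge0.
by rewrite /base -word_classV; apply: XK.
Qed.

(** Some k makes [edge s * k] nonnegative and [edge (~~ s) * k] as negative as
required, because the two edges have opposite signs; pulling a^(edge (~~ s) * k)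
to the left of t^s leaves only nonnegative exponents. *)
Lemma submonoid_stable_zpow s e : (m * n < 0)%R ->
  (bs_a, eps) \in X -> (bs_t, s) \in X -> K (stable s * zpow base e).
Proof.
move=> mn aX sX; have Kb : K base by apply: XK.
have [k [k1 k2]] :
    exists k, (0 <= edge s * k)%R /\ (edge (~~ s) * k <= e)%R.
  have := edge_edgeN m n s; move: (edge s) (edge (~~ s)) => d d' dd'.
  have [d0|d0] := lerP d 0%R; [exists (- `|e|)%R | exists `|e|%R].
    by have d'1 : (1 <= d')%R; [nia | split; nia].
  by have d'1 : (d' <= - 1)%R; [nia | split; nia].
have -> : e = (edge (~~ s) * k + (e - edge (~~ s) * k))%R by ring.
rewrite zpowD mulgA -base_stable; apply: KM; first apply: KM.
- exact: submonoid_zpow.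
- exact: XK.
by apply: submonoid_zpow => //; rewrite subr_ge0.
Qed.

Lemma accepted_cell s r : (r %% edge s)%Z = r ->
  exponent_ok m n eps X r -> K (zpow base r).
Proof.
move=> rs; rewrite /exponent_ok; case: ifPn => [_ /eqP -> //|/negPn aX].
have Kb : K base by apply: XK.
case/or3P => [r0|aX'|mn]; first exact: submonoid_zpow.
  exact: submonoid_zpow_both.
apply: submonoid_zpow => //; rewrite -rs modz_ge0 //; apply/eqP => s0.
by move: mn; rewrite -(edge_edgeN m n s) s0 mul0r ltxx.
Qed.

Lemma accepted_stack stk : reduced m n stk -> all (cell_ok m n eps X) stk ->
  K (stack_val m n eps stk).
Proof.
elim: stk => //= -[r s] stk IHs /and4P[/= /eqP rs _ _ red].
case/andP => /andP[/= sX r_ok] all_ok; apply: KM; first exact: IHs.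
by apply: KM; [exact: accepted_cell rs r_ok | exact: XK].
Qed.

Lemma accepted_submonoid st :
  normal m n st -> accepted m n eps X st -> K (state_val m n eps st).
Proof.
case: st => stk e /andP[/= red _] /andP[/= all_ok]; rewrite /last_ok /state_val /=.
have Kstk := accepted_stack red all_ok.
case: ifPn => [_ /eqP ->|/negPn aX]; first by rewrite mulg1.
have Kb : K base by apply: XK.
case/or3P => [e0|aX'|/andP[mn /orP[stk0|/andP[tX tX']]]].
- by apply: KM => //; apply: submonoid_zpow.
- by apply: KM => //; apply: submonoid_zpow_both.
- case: stk stk0 red all_ok {Kstk} => //= -[r s] stk _ /and4P[/eqP rs _ _ red].
  case/andP => /andP[/= sX r_ok] all_ok.
  rewrite mulgA -(mulgA _ (stable s)); apply: KM.
    by apply: KM; [exact: accepted_stack | exact: accepted_cell rs r_ok].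
  exact: submonoid_stable_zpow.
(* a^e = t^-1 (t a^e), and t a^e is in the submonoid as t is *)
apply: KM => //; rewrite -[zpow _ _](mulKg (stable false)) -stableN.
by apply: KM; [exact: XK | exact: submonoid_stable_zpow].
Qed.

End Completeness.

(** * Computability of the action and of the acceptance test *)

Section Computability.
Variables (m n : int) (eps : bool) (X : {set letter bs_letter}).

Definition cell_code (c : cell) : nat := c.2 + (int_code c.1).*2.
Definition stack_code (stk : seq cell) : nat := code (map cell_code stk).
Definition state_code (st : state) : nat :=
  code (int_code st.2 :: map cell_code st.1).

Section Generic.
Variables (T : Type) (env : T -> seq nat).

Lemma recursive_cell_code (F : T -> int) (s : bool) : recursive_int env F ->
  recursive env (fun x => cell_code (F x, s)).
Proof.
by move=> rF; apply: recursive_add (recursive_const _ s) (recursive_double rF).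
Qed.

Lemma recursive_cell_exponent (F : T -> cell) :
  recursive env (fun x => cell_code (F x)) ->
  recursive_int env (fun x => (F x).1).
Proof.
move/recursive_half; apply: recursive_ext => x.
by rewrite /cell_code half_bit_double.
Qed.

Lemma recursive_cell_sign (F : T -> cell) :
  recursive env (fun x => cell_code (F x)) ->
  recursive_bool env (fun x => (F x).2).
Proof.
move/recursive_odd; apply: recursive_ext => x.
by rewrite /cell_code oddD odd_double addbF oddb.
Qed.

Lemma recursive_state_code (S : T -> seq cell) (F : T -> int) :
  recursive env (fun x => stack_code (S x)) -> recursive_int env F ->
  recursive env (fun x => state_code (S x, F x)).
Proof. by move=> rS rF; apply: recursive_code_cons. Qed.

Lemma recursive_state_last (F : T -> state) :
  recursive env (fun x => state_code (F x)) ->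
  recursive_int env (fun x => (F x).2).
Proof. by move/recursive_code_head. Qed.

Lemma recursive_state_stack (F : T -> state) :
  recursive env (fun x => state_code (F x)) ->
  recursive env (fun x => stack_code (F x).1).
Proof. by move/recursive_code_behead. Qed.

Lemma recursive_stack_behead (S : T -> seq cell) :
  recursive env (fun x => stack_code (S x)) ->
  recursive env (fun x => stack_code (behead (S x))).
Proof.
move/recursive_code_behead; apply: recursive_ext => x.
by rewrite /stack_code behead_map.
Qed.

Lemma recursive_stack_head (S : T -> seq cell) (s : bool) :
  recursive env (fun x => stack_code (S x)) ->
  recursive env (fun x => cell_code (head (0%R, s) (S x))).
Proof.
move=> rS; have := recursive_if (recursive_eq0 rS)
  (recursive_cell_code s (recursive_int_const _ 0%R)) (recursive_code_head rS).
apply: recursive_ext => x; rewrite /stack_code code_eq0; by case: (S x).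
Qed.

Lemma recursive_stack_nilp (S : T -> seq cell) :
  recursive env (fun x => stack_code (S x)) ->
  recursive_bool env (fun x => nilp (S x)).
Proof.
move/recursive_eq0; apply: recursive_ext => x.
by rewrite /stack_code code_eq0 /nilp size_map.
Qed.

Lemma recursive_top_is (s : bool) (S : T -> seq cell) :
  recursive env (fun x => stack_code (S x)) ->
  recursive_bool env (fun x => top_is s (S x)).
Proof.
move=> rS; have := recursive_and (recursive_neg (recursive_stack_nilp rS))
  (recursive_eq (recursive_cell_sign (recursive_stack_head s rS))
     (recursive_const _ s)).
by apply: recursive_ext => x; case: (S x) => //= -[r []] stk; case: s {rS}.
Qed.

End Generic.

Local Notation env := (fun st : state => [:: state_code st]).

Let rec_st : recursive env state_code := recursive_nth env 0.
Let rec_last : recursive_int env (fun st => st.2) := recursive_state_last rec_st.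
Let rec_stk : recursive env (fun st => stack_code st.1) :=
  recursive_state_stack rec_st.

Lemma recursive_shift k : recursive env (fun st => state_code (shift m n k st)).
Proof.
apply: (recursive_state_code (S := fst)) => //.
exact: recursive_int_mod (recursive_int_add rec_last (recursive_int_const _ k)).
Qed.

Lemma recursive_turn s : recursive env (fun st => state_code (turn m n s st)).
Proof.
pose r (st : state) := (st.2 %% edge m n s)%Z.
pose e (st : state) := (edge m n (~~ s) * (st.2 %/ edge m n s)%Z)%R.
have rec_r : recursive_int env r by exact: recursive_int_mod.
have rec_e : recursive_int env e.
  exact: recursive_int_mul (recursive_int_const _ _) (recursive_int_div _ rec_last).
have rec_pop := recursive_state_code (recursive_stack_behead rec_stk)
  (recursive_int_add
    (recursive_cell_exponent (recursive_stack_head s rec_stk)) rec_e).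
have rec_push := recursive_state_code (S := fun st => (r st, s) :: st.1)
  (recursive_code_cons (recursive_cell_code s rec_r) rec_stk) rec_e.
have := recursive_if (recursive_and (recursive_int_eq0 rec_r)
  (recursive_top_is (~~ s) rec_stk)) rec_pop rec_push.
by apply: recursive_ext => st; rewrite /turn; case: ifP.
Qed.

Lemma recursive_act x : recursive env (fun st => state_code (act m n eps st x)).
Proof. by case: x => -[] s; [exact: recursive_shift | exact: recursive_turn]. Qed.

Lemma recursive_cell_ok T (envT : T -> seq nat) (F : T -> cell) :
  recursive envT (fun x => cell_code (F x)) ->
  recursive_bool envT (fun x => cell_ok m n eps X (F x)).
Proof.
move=> rF; have rec_r := recursive_cell_exponent rF.
have rec_s := recursive_cell_sign rF.
have rec_sX := recursive_if rec_s (recursive_const _ ((bs_t, true) \in X))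
  (recursive_const _ ((bs_t, false) \in X)).
have rec_const b : recursive_bool envT (fun=> b) by exact: recursive_const.
have rec_ok := recursive_if (rec_const ((bs_a, eps) \notin X))
  (recursive_int_eq0 rec_r) (recursive_or (recursive_int_ge0 rec_r)
    (rec_const (((bs_a, ~~ eps) \in X) || (m * n < 0)%R))).
have rec_sign : recursive_bool envT (fun x => (bs_t, (F x).2) \in X).
  by apply: recursive_ext rec_sX => x; case: (F x).2.
have rec_exp : recursive_bool envT (fun x => exponent_ok m n eps X (F x).1).
  by apply: recursive_ext rec_ok => x; rewrite /exponent_ok; case: ifP.
exact: recursive_and rec_sign rec_exp.
Qed.

Lemma recursive_all_cell_ok :
  recursive_bool (fun stk => [:: stack_code stk]) (all (cell_ok m n eps X)).
Proof.
have rec_tl := recursive_stack_behead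
  (recursive_nth (fun stk => [:: stack_code stk]) 0).
have size_stk stk : size stk <= stack_code stk.
  by rewrite -(size_map cell_code) size_code.
pose envp (p : seq cell * bool) := [:: stack_code p.1; p.2 : nat].
have rec_1 : recursive envp (fun p => stack_code p.1) := recursive_nth envp 0.
have rec_2 : recursive_bool envp (fun p => p.2) := recursive_nth envp 1.
have rec_step : recursive envp (fun p => nat_of_bool
    (if p.1 is c :: _ then p.2 && cell_ok m n eps X c else p.2)).
  have := recursive_if (recursive_stack_nilp rec_1) rec_2 (recursive_and rec_2
    (recursive_cell_ok (recursive_stack_head false rec_1))).
  by apply: recursive_ext => -[[|c stk] b].
have := recursive_foldl (step := fun b c => b && cell_ok m n eps X c) true
  size_stk rec_tl rec_step.
apply: recursive_ext => stk; congr nat_of_bool.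
rewrite -[RHS]andTb; elim: stk true => [|c stk IHs] b /=; first by rewrite andbT.
by rewrite IHs andbA.
Qed.

Lemma recursive_accepted : recursive_bool env (accepted m n eps X).
Proof.
have rec_const b : recursive_bool env (fun=> b) by exact: recursive_const.
have := recursive_if (rec_const ((bs_a, eps) \notin X))
  (recursive_int_eq0 rec_last) (recursive_or (recursive_int_ge0 rec_last)
   (recursive_or (rec_const ((bs_a, ~~ eps) \in X))
     (recursive_and (rec_const (m * n < 0)%R)
       (recursive_or (recursive_neg (recursive_stack_nilp rec_stk))
         (rec_const (((bs_t, false) \in X) && ((bs_t, true) \in X))))))).
move=> rec_ok; have : recursive_bool env (last_ok m n eps X).
  by apply: recursive_ext rec_ok => st; rewrite /last_ok; case: ifP.
have rec_all := recursive_comp1 (f1 := fst) recursive_all_cell_ok rec_stk.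
exact: recursive_and rec_all.
Qed.

End Computability.

(** * Decidability of membership *)

Theorem theorem4p6 (m n : int) (M : set (BS m n)) :
  magnus_submonoid M ->
  membership_decidable (one_relator_gen (BS_relator m n)) M.
Proof.
move=> [X [_ ->]]; rewrite /membership_decidable.
(* the base group is generated by a if a is in X, and by a^-1 otherwise *)
pose eps := (bs_a, false) \notin X.
have Xeps : (bs_a, ~~ eps) \in X -> (bs_a, eps) \in X.
  by rewrite /eps; case E: ((bs_a, false) \in X); rewrite /= E.
have normal0 : normal m n ([::], 0%R) by rewrite /normal /= mod0z.
have accepted0 : accepted m n eps X ([::], 0%R).
  by rewrite /accepted /last_ok /=; case: ifP.
have state0 : state_val m n eps ([::], 0%R) = 1%g by rewrite /state_val mulg1.
apply: (@word_decidable_automaton _ _ state_code (act m n eps) ([::], 0%R)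
  (accepted m n eps X)).
- exact: recursive_act.
- exact: recursive_accepted.
move=> w; rewrite /= word_valE; split=> [|acc].
  case/submonoid_generatedP => u uX /word_classP wu.
  by rewrite (foldl_pres_eq eps normal0 wu); apply: accepted_foldl.
have := accepted_submonoid (@submonoid_generated_sub _ _ X)
  (@submonoid_generated_gen _ _ X) (normal_foldl eps w normal0) acc.
by rewrite state_val_foldl state0 mul1g.
Qed.
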